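(* Let $X,Y$ be Banach spaces and let $-A$ be the generator of a bounded strongly continuous semigroup $(T(t))_{t\ge0}$ on $X$; assume $A$ is injective and has dense range. Let $C:\mathcal D(A)\to Y$ be bounded (for the graph norm). Suppose there exist $\beta\in(0,1)$ and constants $K,\delta>0$ such that (SQ$_\beta$) $\|x\|^2\le K^2\int_0^\infty\|(tA)^{-\beta}(T(2t^{2\beta})-T(t^{2\beta}))x\|^2\,\frac{dt}{t}$ for all $x\in X$, and (R$_\beta$) $\|CA^{-(1-\beta)}x\|_Y\ge\delta\|x\|$ for all $x\in\mathcal D(A)\cap\mathcal R(A)$ (understood as $\|CA^{-1}x\|_Y\ge\delta\|A^{-\beta}x\|$). Then there exists a constant $m>0$ such that $m^2\|x\|^2\le\int_0^\infty\|CT(t)x\|_Y^2\,dt$ for all $x\in\mathcal D(A)\cap\mathcal R(A)$.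
   Context: $\mathcal D(A)$, $\mathcal R(A)$ denote domain and range of $A$. Since $-A$ generates a bounded semigroup, $A$ is sectorial and, being injective, has fractional powers $A^{-\gamma}$ ($\gamma\in(0,1]$), the inverses of the fractional powers $A^{\gamma}$; $(tA)^{-\beta}=t^{-\beta}A^{-\beta}$. *)

(* Defs.v *)
From HB Require Import structures.
From mathcomp Require Import all_boot all_order all_algebra.
From mathcomp Require Import all_classical all_reals all_analysis.
Set Implicit Arguments. Unset Strict Implicit. Unset Printing Implicit Defensive.
Import Order.TTheory GRing.Theory Num.Theory.
Import numFieldNormedType.Exports.
Local Open Scope classical_set_scope.
Local Open Scope ring_scope.

Section Defs.
Variable R : realType.

Definition Gamma (g : R) : R :=
  Rintegral lebesgue_measure `]0, +oo[ (fun t => t `^ (g - 1) * expR (- t)).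

Variable X : completeNormedModType R.

(* Riemann integral on [a,b] of a (continuous) vector-valued function,
   as the limit of uniform left Riemann sums. *)
Definition vint (f : R -> X) (a b : R) : X :=
  lim ((fun n : nat => ((b - a) / n.+1%:R) *:
          \sum_(k < n.+1) f (a + k%:R * (b - a) / n.+1%:R)) @ \oo).

Definition vint0oo (f : R -> X) : X :=
  lim ((fun ab : R * R => vint f ab.1 ab.2) @ filter_prod (0 ^'+) (pinfty_nbhs R)).

Definition bounded_C0_semigroup (T : R -> X -> X) : Prop :=
  (forall t, 0 <= t -> forall (a : R) (u v : X), T t (a *: u + v) = a *: T t u + T t v) /\
  [/\ 
(forall t, 0 <= t -> continuous (T t)),
      (forall x, T 0 x = x),
      (forall s t x, 0 <= s -> 0 <= t -> T (s + t) x = T s (T t x)),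
      (forall x, T t x @[t --> 0 ^'+] --> x) &
      (exists M : R, forall t x, 0 <= t -> `|T t x| <= M * `|x|)].

Definition generator (T : R -> X -> X) (D : set X) (G : X -> X) : Prop :=
  D = [set x | cvg ((fun h => h^-1 *: (T h x - x)) @ 0 ^'+)] /\
  (forall x, D x -> (h^-1 *: (T h x - x)) @[h --> 0 ^'+] --> G x).

Definition op_inv (D : set X) (A : X -> X) (z : X) : X :=
  xget 0 [set y | D y /\ A y = z].

(* Negative fractional power A^{-g} on the range of A, for -A generating the
   bounded semigroup T (Balakrishnan/Phillips representation):
   A^{-g} z = 1/Gamma(g) * int_0^oo t^(g-1) T(t) z dt. *)
Definition frac_neg (T : R -> X -> X) (g : R) (z : X) : X :=
  (Gamma g)^-1 *: vint0oo (fun t => t `^ (g - 1) *: T t z).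

End Defs.

(* Main.v *)
(* Write x = A w with w, x in D(A).  With s = t^(2 beta), the vector
   z = (T(2s) - T(s)) x equals A y for y = (T(2s) - T(s)) w, so injectivity gives
   A^{-1} z = y and (R_beta) bounds |A^{-beta} z| by |C y| / delta; no other
   property of the fractional power is needed.  Since C T(.) w has derivative
   - C T(.) x, Cauchy-Schwarz gives |C y|^2 <= s int_s^{2s} |C T(u) x|^2 du.
   Inserting this in (SQ_beta), the factor s cancels t^{-2 beta}, and Tonelli
   finishes: for fixed u, the t with t^(2 beta) <= u < 2 t^(2 beta) fill at
   most an interval [a, q a] with q = 2^(1/(2 beta)), whose dt/t-measure is
   at most q. *)
Require Import Defs.
From HB Require Import structures.
From mathcomp Require Import all_boot all_order all_algebra.
From mathcomp Require Import all_classical all_reals all_analysis.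
From mathcomp Require Import measurable_realfun ring lra.
Set Implicit Arguments. Unset Strict Implicit.
Import Order.TTheory GRing.Theory Num.Theory.
Import numFieldNormedType.Exports.
Local Open Scope classical_set_scope.
Local Open Scope ring_scope.

(** * Integral estimates on the half-line *)

(** Monotonicity read off from the supremum over simple functions. It serves integrands whose
    measurability is never established, such as the one containing [frac_neg]. *)
Lemma ge0_le_integral_nomeas d (T : measurableType d) (R : realType)
  (mu : {measure set T -> \bar R}) (D : set T) (f g : T -> \bar R) :
  (forall x, D x -> 0 <= f x)%E -> (forall x, D x -> f x <= g x)%E ->
  (\int[mu]_(x in D) f x <= \int[mu]_(x in D) g x)%E.
Proof.
move=> f0 fg; have g0 x : D x -> (0 <= g x)%E.
  by move=> Dx; exact: le_trans (f0 x Dx) (fg x Dx).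
rewrite !ge0_integralE//; apply: ereal_sup_le => _ [h hf <-].
exists h => // x; apply: le_trans (hf x) _.
rewrite /patch; case: ifPn => // /set_mem; exact: fg.
Qed.

Lemma integral_cst_itv (R : realType) (i : interval R) (c : R) :
  (\int[lebesgue_measure]_(x in [set` i]) c%:E =
    c%:E * (if i.1 < i.2 then (i.2 : \bar R) - i.1 else 0))%E.
Proof. by rewrite -lebesgue_measure_itv; exact: integral_cst. Qed.

(** Apply the increasing power 1/p to u/2 <= t^p <= u, and factor u^(1/p) as 2^(1/p) (u/2)^(1/p). *)
Lemma powR_section_bounds (R : realType) (p t u : R) :
  0 < p -> 0 < t -> t `^ p <= u -> u <= 2 * t `^ p ->
  (u / 2) `^ p^-1 <= t <= 2 `^ p^-1 * (u / 2) `^ p^-1.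
Proof.
move=> p0 t0 tu ut.
have tp0 : 0 < t `^ p by exact: powR_gt0.
have u0 : 0 < u by exact: lt_le_trans tu.
have tE : t = (t `^ p) `^ p^-1.
  by rewrite -powRrM mulfV ?gt_eqF// powRr1// ltW.
have pV : 0 <= p^-1 by rewrite invr_ge0 ltW.
apply/andP; split.
  rewrite [leRHS]tE; apply: ge0_ler_powR => //; rewrite ?nnegrE ?divr_ge0 ?(ltW u0) ?(ltW tp0)//.
  by rewrite ler_pdivrMr// mulrC.
rewrite -powRM ?divr_ge0 ?(ltW u0)// mulrC divfK// [leLHS]tE.
by apply: ge0_ler_powR => //; rewrite nnegrE ltW.
Qed.

(** After Tonelli, [G u] is weighted by the dt/t-measure of the section at u. That section lies in
    [a, q a], where 1/t <= 1/a and the length is (q - 1) a, so the weight is at most q - 1 <= q. *)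
Lemma dilation_integral_le (R : realType) (p : R) (G : R -> R) :
  0 < p -> measurable_fun setT G -> (forall u, 0 <= G u) ->
  (\int[lebesgue_measure]_(t in `]0%R, +oo[)
      ((t^-1)%R%:E * \int[lebesgue_measure]_(u in `[(t `^ p)%R, (2 * t `^ p)%R[) (G u)%:E)
   <= (2 `^ p^-1)%R%:E * \int[lebesgue_measure]_(u in `[0%R, +oo[) (G u)%:E)%E.
Proof.
move=> p0 mG G0; set q := 2 `^ p^-1.
pose P (z : R * R) := [&& 0 < z.1, z.1 `^ p <= z.2 & z.2 < 2 * z.1 `^ p].
(* The power -1 agrees with the inverse for t > 0 and makes [f] jointly measurable through the
   measurability of real powers. *)
pose f (z : R * R) := if P z then z.1 `^ (-1) * G z.2 else 0.
have f0 z : (0 <= (f z)%:E)%E.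
  rewrite /f lee_fin; case: ifPn => // /and3P[z0 _ _].
  by rewrite mulr_ge0// powR_ge0.
have mp : measurable_fun [set: R * R] (fun z => z.1 `^ p).
  by apply: (measurableT_comp (measurable_powR p)); exact: measurable_fst.
have mF : measurable_fun [set: R * R] (EFin \o f).
  apply/measurable_EFinP; apply: measurable_fun_ifT => //.
    apply: measurable_and; first exact: measurable_fun_ltr.
    apply: measurable_and; first exact: measurable_fun_ler.
    apply: measurable_fun_ltr => //; exact: measurable_funM.
  apply: measurable_funM; last exact: (measurableT_comp mG).
  by apply: (measurableT_comp (measurable_powR (-1))).
have -> : (\int[lebesgue_measure]_(t in `]0%R, +oo[)
      ((t^-1)%R%:E * \int[lebesgue_measure]_(u in `[(t `^ p)%R, (2 * t `^ p)%R[) (G u)%:E)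
    = \int[lebesgue_measure]_t \int[lebesgue_measure]_u (f (t, u))%:E)%E.
  rewrite integral_mkcond; apply: eq_integral => t _.
  rewrite patchE; case: ifPn => [/set_mem/=|/negP nt].
    rewrite in_itv/= andbT => t0.
    rewrite -ge0_integralZl_EFin//; last 3 first.
    - by move=> u _; rewrite lee_fin.
    - by apply/measurable_EFinP; exact: measurable_funTS.
    - by rewrite invr_ge0 ltW.
    rewrite integral_mkcond; apply: eq_integral => u _.
    rewrite patchE /f /P/= t0/= mem_setE in_itv/=.
    by rewrite powR_inv1 ?(ltW t0)//; case: (t `^ p <= u < 2 * t `^ p).
  apply/esym; apply: integral0_eq => u _; rewrite /f /P/=.
  by case: ifPn => // /and3P[t0 _ _]; case: nt; rewrite inE/= in_itv/= t0.
have -> := @fubini_tonelli _ _ (measurableTypeR R) (measurableTypeR R) R lebesgue_measure lebesgue_measure _ mF f0.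
rewrite -ge0_integralZl_EFin//; last 3 first.
- by move=> u _; rewrite lee_fin.
- by apply/measurable_EFinP; exact: measurable_funTS.
- exact: powR_ge0.
rewrite [leRHS]integral_mkcond; apply: ge0_le_integral_nomeas => u _.
  by apply: integral_ge0 => t _; exact: f0.
have [u0|u0] := leP u 0.
  rewrite integral0_eq.
    by apply: erestrict_ge0 => v _; rewrite mule_ge0// lee_fin// powR_ge0.
  move=> t _; rewrite /f /P/=; case: ifPn => // /and3P[t0 tu _].
  by have := lt_le_trans (powR_gt0 p t0) tu; rewrite ltNge u0.
rewrite patchE mem_set/=; last by rewrite in_itv/= ltW.
pose a := (u / 2) `^ p^-1.
have a0 : 0 < a by rewrite powR_gt0// divr_gt0.
have q1 : 1 <= q.
  have := @ler_powR R 2 (ltac:(by rewrite ler1n)) 0 p^-1.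
  by rewrite powRr0; apply; rewrite invr_ge0 ltW.
have : (\int[lebesgue_measure]_x (f (x, u))%:E <=
    \int[lebesgue_measure]_(t in `[a, (q * a)%R]) (a^-1 * G u)%R%:E)%E.
  rewrite [leRHS]integral_mkcond; apply: ge0_le_integral_nomeas => t _ //.
  rewrite /f /P/=; case: ifPn => [/and3P[t0 tu ut]|_]; last first.
    apply: erestrict_ge0 => v _ /=.
    by rewrite lee_fin mulr_ge0// invr_ge0 ltW.
  have /andP[at_ tqa] := powR_section_bounds p0 t0 tu (ltW ut).
  rewrite patchE mem_set/= ?in_itv/= ?at_//.
  by rewrite lee_fin ler_wpM2r// powR_inv1 ?(ltW t0)// lef_pV2 ?posrE.
have -> := integral_cst_itv `[a, q * a]; rewrite /= lte_fin => /le_trans; apply.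
case: ifPn => _; last by rewrite mule0 mule_ge0// lee_fin// powR_ge0.
rewrite -EFinD -!EFinM lee_fin mulrAC ler_wpM2r//.
by rewrite mulrC ler_pdivrMr// gerBl ltW.
Qed.

(** * Cauchy-Schwarz for increments *)

Section increment.
Variables (R : realType) (Y : normedModType R).
Variables (phi : R -> Y) (g : R -> R).
Hypothesis mg : measurable_fun setT g.
(** Replaces a bound of the derivative of [phi] by [g]: one threshold [h0] serves every u, and [g]
    may be sampled anywhere in [u, u + h]. *)
Hypothesis phi_g : forall eta, 0 < eta -> exists2 h0, 0 < h0 &
  forall h u r, 0 < h < h0 -> 0 <= u -> 0 <= r <= h ->
    `|phi (u + h) - phi u| <= h * (g (u + r) + eta).

(** Half-open, so that adjacent intervals are disjoint and [J] is additive. *)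
Let J a b := (\int[lebesgue_measure]_(u in `[a, b[) (g u ^+ 2)%:E)%E.

Let mg2 D : measurable_fun D (fun u : measurableTypeR R => (g u ^+ 2)%:E).
Proof.
apply/measurable_EFinP; apply: measurable_funTS.
by apply: measurable_funX.
Qed.

Let J0 a b : (0 <= J a b)%E.
Proof. by apply: integral_ge0 => u _; rewrite lee_fin sqr_ge0. Qed.

(** Integrate 2 l g <= l^2 + g^2 over a short interval. With a free parameter l the bound stays
    linear in the increment, hence can be summed over adjacent intervals. *)
Lemma increment_step (l eta : R) : 0 <= l -> 0 < eta ->
  exists2 h0, 0 < h0 & forall h u, 0 < h < h0 -> 0 <= u ->
    ((2 * l * `|phi (u + h) - phi u|)%:E <=
     (h * (l ^+ 2 + 2 * l * eta))%:E + J u (u + h)%R)%E.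
Proof.
move=> l0 /[dup] eta0 /phi_g[h0 h00 H]; exists h0 => // h u /[dup] hh /andP[hp _] u0.
set d := `|_|; set c := l ^+ 2 + _.
pose k := 2 * l * d / h.
have kg v : v \in `[u, u + h[ -> k - c <= g v ^+ 2.
  rewrite in_itv/= => /andP[uv vh].
  have := H h u (v - u) hh u0; rewrite subr_ge0 uv lerBlDl ltW//= subrKC.
  move=> /(_ isT) dv.
  have : k <= 2 * l * (g v + eta).
    by rewrite /k -mulrA ler_wpM2l ?mulr_ge0// ler_pdivrMr// mulrC.
  rewrite /c => {}dv; have := sqr_ge0 (g v - l); nra.
(* If k <= c, the term [h * c] suffices alone; otherwise k - c is a positive constant below g^2 and
   can be integrated. *)
have [kc|kc] := leP k c.
  apply: (@le_trans _ _ (h * c)%:E); last by rewrite leeDl.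
  by rewrite lee_fin [leRHS]mulrC -ler_pdivrMr.
rewrite -leeBlDl// -EFinB.
have : (\int[lebesgue_measure]_(v in `[u, (u + h)%R[) (k - c)%:E <=
        J u (u + h)%R)%E.
  by apply: ge0_le_integral => // v _; rewrite lee_fin subr_ge0 ltW.
have -> := integral_cst_itv `[u, u + h[; rewrite /= lte_fin ltrDl hp.
move=> Hk; apply: le_trans Hk.
rewrite -EFinD -EFinM lee_fin /k.
by rewrite addrAC subrr add0r mulrBl divfK ?gt_eqF// (mulrC c).
Qed.

(** Cut [a, a + s] into N + 1 equal steps shorter than [h0]: increments are subadditive and the
    right side is additive. *)
Lemma increment_le (l eta a s : R) : 0 <= l -> 0 < eta -> 0 <= a -> 0 < s ->
  ((2 * l * `|phi (a + s) - phi a|)%:E <=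
     (s * (l ^+ 2 + 2 * l * eta))%:E + J a (a + s)%R)%E.
Proof.
move=> l0 eta0 a0 s0; have [h0 h00 H] := increment_step l0 eta0.
have [N Nh] : exists N : nat, s / h0 < N.+1%:R.
  exists (Num.truncn (s / h0)); exact: truncnS_gt.
pose h := s / N.+1%:R.
have hp : 0 < h by rewrite divr_gt0.
have hh0 : h < h0 by rewrite /h ltr_pdivrMr// mulrC -ltr_pdivrMr.
set c := l ^+ 2 + _.
have sE : s = h * N.+1%:R by rewrite divfK.
suff Hn n : ((2 * l * `|phi (a + h * n%:R) - phi a|)%:E <=
     (h * n%:R * c)%:E + J a (a + h * n%:R)%R)%E by have := Hn N.+1; rewrite -sE.
elim: n => [|n IH].
  by rewrite mulr0 addr0 subrr normr0 mulr0 mul0r add0e; exact: J0.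
have anp : 0 <= a + h * n%:R by rewrite addr_ge0// mulr_ge0// ltW.
have := H h (a + h * n%:R); rewrite hp hh0 => /(_ isT anp) {}H.
have bE : a + h * n.+1%:R = a + h * n%:R + h.
  by rewrite -natr1 mulrDr mulr1 addrA.
rewrite bE; set b := a + h * n%:R in anp H IH *.
have -> : J a (b + h)%R = (J a b + J b (b + h)%R)%E.
  have ab : a <= b by rewrite lerDl mulr_ge0// ltW.
  rewrite /J -ge0_integral_setU//.
  - by rewrite -itv_bndbnd_setU// bnd_simp lerDl ltW.
  - by move=> u _; rewrite lee_fin sqr_ge0.
  - apply/disj_set2P/seteqP; split => // u [] /=.
    by rewrite !in_itv/= => /andP[_ ub] /andP[bu _]; move: ub; rewrite ltNge bu.
apply: (@le_trans _ _ ((2 * l * `|phi b - phi a|)%:E +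
                       (2 * l * `|phi (b + h) - phi b|)%:E)%E).
  rewrite -EFinD lee_fin -mulrDr ler_wpM2l ?mulr_ge0//.
  have -> : phi (b + h) - phi a = phi b - phi a + (phi (b + h) - phi b).
    by rewrite [RHS]addrC subrKA.
  exact: ler_normD.
apply: le_trans (leeD IH H) _.
rewrite -[n.+1%:R]natr1 (_ : h * (n%:R + 1) * c = h * n%:R * c + h * c); last by ring.
by rewrite EFinD addeACA.
Qed.

(** The choice l = d / s maximises 2 l d - s l^2, with value d^2 / s; then eta tends to 0. An
    infinite [J] is trivial. *)
Lemma sqr_increment_le (a s : R) : 0 <= a -> 0 < s ->
  ((`|phi (a + s) - phi a| ^+ 2)%:E <= s%:E * J a (a + s)%R)%E.
Proof.
move=> a0 s0; set d := `|phi (a + s) - phi a|.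
have d0 : 0 <= d by exact: normr_ge0.
have H eta (e0 : 0 < eta) := increment_le (divr_ge0 d0 (ltW s0)) e0 a0 s0.
move: H (J0 a (a + s)); rewrite -/d.
case: (J a (a + s)%R) => [j||//] H; last by rewrite gt0_muley ?leey ?lte_fin.
rewrite lee_fin => j0; rewrite -EFinM lee_fin.
have H2 eta : 0 < eta -> d ^+ 2 / s <= j + 2 * d * eta.
  move/H; rewrite -EFinD lee_fin.
  rewrite (_ : 2 * (d / s) * d = d ^+ 2 / s + d ^+ 2 / s); last by field; rewrite gt_eqF.
  rewrite (_ : s * _ = d ^+ 2 / s + 2 * d * eta); last by field; rewrite gt_eqF.
  lra.
rewrite -ler_pdivrMl// mulrC; apply/ler_addgt0Pr => e e0.
have de : 0 < 2 * d + 1 by lra.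
(* The added 1 keeps the denominator positive when d = 0. *)
apply: le_trans (H2 (e / (2 * d + 1)) (divr_gt0 e0 de)) _.
by rewrite lerD2l mulrA ler_pdivrMr//; nra.
Qed.

End increment.

Lemma at_right0P (R : realType) (P : R -> Prop) :
  (\forall h \near 0^'+, P h) <->
  exists2 e : R, 0 < e & forall h, 0 < h < e -> P h.
Proof.
split=> [[e /= e0 H]|[e e0 H]]; exists e => //.
  move=> h /andP[h0 he]; apply: H => //=.
  by rewrite sub0r normrN gtr0_norm.
move=> h /= + h0; rewrite sub0r normrN gtr0_norm// => he.
by apply: H; rewrite h0.
Qed.

(** * The generator and its domain *)

Section generator.
Variables (R : realType) (X : completeNormedModType R).
Variables (T : R -> X -> X) (D : set X) (A : X -> X).
Hypothesis sgT : bounded_C0_semigroup T.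
Hypothesis genA : generator T D (fun x => - A x).

Let TL t (t0 : 0 <= t) a u v : T t (a *: u + v) = a *: T t u + T t v.
Proof. by case: sgT => + _; exact. Qed.

Let TB t (t0 : 0 <= t) u v : T t (u - v) = T t u - T t v.
Proof. by rewrite addrC -scaleN1r TL// scaleN1r addrC. Qed.

Let T0 t (t0 : 0 <= t) : T t 0 = 0.
Proof. by rewrite -[X in T t X](subrr 0) TB// subrr. Qed.

Let TZ t (t0 : 0 <= t) a u : T t (a *: u) = a *: T t u.
Proof. by rewrite -[a *: u]addr0 TL// T0// addr0. Qed.

Let Tcvg x : T h x @[h --> 0^'+] --> x.
Proof. by case: sgT => _ []. Qed.

Lemma generator_quotient_cvg w : D w ->
  h^-1 *: (T h w - w) @[h --> 0^'+] --> - A w.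
Proof. by case: genA => _; exact. Qed.

(** Membership in [D] and the value of [A] are obtained together by exhibiting the limit of the
    difference quotient; the sign appears because -A is the generator. *)
Lemma generator_of_cvg w l :
  h^-1 *: (T h w - w) @[h --> 0^'+] --> l -> D w /\ A w = - l.
Proof.
move=> wl; have Dw : D w by case: genA => -> _; apply/cvg_ex; exists l.
split=> //; apply/eqP; rewrite -eqr_oppLR; apply/eqP.
exact: (cvg_unique (@norm_hausdorff _ _) (generator_quotient_cvg Dw) wl).
Qed.

Lemma generator_linear a u v : D u -> D v ->
  D (a *: u + v) /\ A (a *: u + v) = a *: A u + A v.
Proof.
move=> Du Dv.
have [|Dauv ->] := @generator_of_cvg (a *: u + v) (a *: (- A u) + - A v).
  apply: cvg_trans (cvgD (cvgZl_tmp (k := a) (generator_quotient_cvg Du))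
                         (generator_quotient_cvg Dv)).
  apply: near_eq_cvg; near=> h.
  have h0 : 0 <= h by near: h; exact: nbhs_right_ge.
  rewrite /= TL//.
  change (a *: (h^-1 *: (T h u - u)) + h^-1 *: (T h v - v) =
    h^-1 *: (a *: T h u + T h v - (a *: u + v))).
  by rewrite scalerA mulrC -scalerA -scalerDr scalerBr opprD addrACA.
by split=> //; rewrite scalerN -opprD opprK.
Unshelve. all: by end_near. Qed.

(** [T t] commutes with [T h], so the quotient at [T t w] is the image under the continuous map
    [T t] of the quotient at w. *)
Lemma generator_semigroup t w : 0 <= t -> D w ->
  D (T t w) /\ A (T t w) = T t (A w).
Proof.
move=> t0 Dw.
have [|Dt ->] := @generator_of_cvg (T t w) (T t (- A w)); last first.
  by split=> //; rewrite -(scaleN1r (A w)) TZ// scaleN1r opprK.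
have Tc : continuous (T t) by case: sgT => _ [+ _ _ _ _]; exact.
apply: cvg_trans (cvg_comp _ _ (generator_quotient_cvg Dw) (Tc _)).
apply: near_eq_cvg; near=> h.
have h0 : 0 <= h by near: h; exact: nbhs_right_ge.
rewrite /= TZ// TB//; congr (_ *: (_ - _)).
by case: sgT => _ [_ _ TD _ _]; rewrite -!TD// addrC.
Unshelve. all: by end_near. Qed.

(** * Regularity of the observed orbits u -> C T(u) x *)

Variables (Y : normedModType R) (C : X -> Y).
Hypothesis CL : forall a u v, D u -> D v -> C (a *: u + v) = a *: C u + C v.
Hypothesis Cbnd : exists c, forall x, D x -> `|C x| <= c * (`|x| + `|A x|).

Lemma observation_bounded : exists2 B, 0 <= B & forall u v, 0 <= u -> D v ->
  `|C (T u v)| <= B * (`|v| + `|A v|).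
Proof.
have [c cC] := Cbnd; case: sgT => _ [_ _ _ _ [M TM]].
(* Absolute values, as neither [c] nor [M] is given with a sign. *)
exists (`|c| * `|M|) => [|u v u0 Dv]; first exact: mulr_ge0.
have [DT AT] := generator_semigroup u0 Dv.
apply: le_trans (cC _ DT) _; rewrite AT -mulrA.
have le_abs (k z : R) (z0 : 0 <= z) : k * z <= `|k| * z.
  by apply: ler_wpM2r => //; exact: ler_norm.
apply: le_trans (le_abs _ _ _) _; first by rewrite addr_ge0.
rewrite ler_wpM2l// mulrDr lerD//.
  by apply: le_trans (TM _ _ u0) _; exact: le_abs.
by apply: le_trans (TM _ _ u0) _; exact: le_abs.
Qed.

Lemma generator_subr u v : D u -> D v -> D (u - v) /\ A (u - v) = A u - A v.
Proof.
move=> Du Dv; have := generator_linear (-1) Dv Du.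
by rewrite !scaleN1r ![- _ + _]addrC.
Qed.

Lemma observation_subr u v : D u -> D v -> C (u - v) = C u - C v.
Proof. by move=> Du Dv; rewrite addrC -scaleN1r CL// scaleN1r addrC. Qed.

Lemma semigroup_addB u r x : 0 <= u -> 0 <= r ->
  T (u + r) x - T u x = T u (T r x - x).
Proof. by move=> u0 r0; case: sgT => _ [_ _ TD _ _]; rewrite TD// TB. Qed.

(* The modulus of continuity is uniform in the base point [u]: by the
   semigroup law the increment at [u] is [T u] applied to the one at [0]. *)
Lemma observation_unif_cont x : D x -> forall eta, 0 < eta ->
  exists2 h0, 0 < h0 & forall u r, 0 <= u -> 0 <= r < h0 ->
    `|C (T (u + r) x) - C (T u x)| <= eta.
Proof.
move=> Dx eta eta0; have [B B0 CB] := observation_bounded.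
pose e := eta / (2 * (B + 1)).
have e0 : 0 < e by rewrite divr_gt0// mulr_gt0// ltr_wpDl.
have e2B : B * (e + e) <= eta.
  have : e * (2 * (B + 1)) = eta by rewrite divfK// gt_eqF// mulr_gt0// ltr_wpDl.
  nra.
(* Strong continuity is used at both x and A x, since [C] is controlled by the graph norm. *)
have /at_right0P[h0 h00 H] : \forall h \near 0^'+,
    `|T h x - x| <= e /\ `|T h (A x) - A x| <= e.
  near=> h; split; near: h.
    exact: ((cvgrPdistC_le _ _).1 (@Tcvg _) e e0).
  exact: ((cvgrPdistC_le _ _).1 (@Tcvg _) e e0).
exists h0 => // u r u0 /andP[r0 rh].
have [Dr Ar] := generator_semigroup r0 Dx.
have [DB AB] := generator_subr Dr Dx.
rewrite -observation_subr; last 2 first.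
- by have [] := generator_semigroup (addr_ge0 u0 r0) Dx.
- by have [] := generator_semigroup u0 Dx.
rewrite semigroup_addB//; apply: le_trans (CB _ _ u0 DB) _.
apply: le_trans e2B; rewrite ler_wpM2l// AB Ar.
(* Right neighbourhoods of 0 exclude 0 itself, so r = 0 is treated apart. *)
have [->|rp] := eqVneq r 0.
  case: sgT => _ [_ Tid _ _ _]; rewrite !Tid !subrr !normr0 lerD ?ltW//.
by have [? ?] := H r (ltac:(by rewrite lt0r rp r0)); rewrite lerD.
Unshelve. all: by end_near. Qed.

(** Clamping the time at 0 extends the observed orbit to a continuous function on the whole line. *)
Lemma observation_measurable x : D x ->
  measurable_fun [set: R] (fun u : R => `|C (T (Num.max 0 u) x)|).
Proof.
move=> Dx; apply: continuous_measurable_fun => u.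
apply/cvgrPdist_le => e /(observation_unif_cont Dx)[h0 h00 H].
have H2 v v' : 0 <= v -> v <= v' -> v' < v + h0 ->
    `| `|C (T v' x)| - `|C (T v x)| | <= e.
  move=> v0 vv' v'h; apply: le_trans (ler_dist_dist _ _) _.
  rewrite -[v'](subrKC v); apply: H => //.
  by rewrite subr_ge0 vv' ltrBlDl.
near=> v.
have : `|u - v| < h0 by near: v; exact: cvgr_dist_lt.
rewrite ltr_norml ltrBlDl ltrBrDl => /andP[uv vu].
have m0 (w : R) : 0 <= Num.max 0 w by rewrite le_max lexx.
have max_lt (w w' : R) : w < w' + h0 -> Num.max 0 w < Num.max 0 w' + h0.
  move=> ww'; rewrite gt_max ltr_wpDl//=.
  by apply: lt_le_trans ww' _; rewrite lerD2r le_max lexx orbT.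
(* The modulus is one-sided, so the smaller of the two times is the base point. *)
have [vm|vm] := leP v u.
  apply: H2 => //; first by rewrite ge_max m0 le_max vm orbT.
  by apply: max_lt; lra.
rewrite distrC; apply: H2 => //; first by rewrite ge_max m0 le_max (ltW vm) orbT.
by apply: max_lt; lra.
Unshelve. all: by end_near. Qed.

(** Split T(h) w - w into -h A w and a remainder. As w and A w both lie in [D], the remainder is
    o(h) in the graph norm, and [observation_bounded] makes this uniform in u. Uniform continuity
    then moves the main term from u to u + r. *)
Lemma observation_increment w : D w -> D (A w) -> forall eta, 0 < eta ->
  exists2 h0, 0 < h0 & forall h u r, 0 < h < h0 -> 0 <= u -> 0 <= r <= h ->
    `|C (T (u + h) w) - C (T u w)| <=
      h * (`|C (T (Num.max 0 (u + r)) (A w))| + eta).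
Proof.
move=> Dw Dx eta eta0; have [B B0 CB] := observation_bounded.
have [h1 h10 H1] := observation_unif_cont Dx (divr_gt0 eta0 (ltr0Sn R 1)).
(* Half of eta pays for the remainder, the other half for the shift from u to u + r. *)
pose e := eta / (4 * (B + 1)).
have e0 : 0 < e by rewrite divr_gt0// mulr_gt0// ltr_wpDl.
have e2B : B * (e + e) <= eta / 2.
  have : e * (4 * (B + 1)) = eta by rewrite divfK// gt_eqF// mulr_gt0// ltr_wpDl.
  nra.
have quot v (Dv : D v) :
    (\forall h \near 0^'+, `|h *: A v + (T h v - v)| <= h * e).
  near=> h.
  have h0 : 0 < h by near: h; exact: nbhs_right_gt.
  have : `|h^-1 *: (T h v - v) - - A v| <= e.
    near: h; exact: ((cvgrPdistC_le _ _).1 (generator_quotient_cvg Dv) e e0).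
  rewrite -(ler_pM2l h0) -{1}[h]gtr0_norm// -normrZ opprK scalerDr scalerA.
  by rewrite mulfV ?gt_eqF// scale1r addrC.
have /at_right0P[h2 h20 H2] : \forall h \near 0^'+,
    `|h *: A w + (T h w - w)| <= h * e /\
    `|h *: A (A w) + (T h (A w) - A w)| <= h * e.
  by near=> h; split; near: h; exact: quot.
exists (Num.min h1 h2) => [|h u r]; first by rewrite lt_min h10.
rewrite lt_min => /and3P[hp hh1 hh2] u0 /andP[r0 rh].
have [He1 He2] := H2 h (ltac:(by rewrite hp hh2)).
have h0 := ltW hp.
have [DT AT] := generator_semigroup h0 Dw.
have [DB AB] := generator_subr DT Dw.
have [De Ae] := generator_linear h Dx DB.
rewrite AB AT in Ae.
rewrite -observation_subr; last 2 first.
- by have [] := generator_semigroup (addr_ge0 u0 h0) Dw.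
- by have [] := generator_semigroup u0 Dw.
rewrite semigroup_addB//.
have CE := CL h (generator_semigroup u0 Dx).1 (generator_semigroup u0 DB).1.
rewrite -TL// in CE.
have -> : C (T u (T h w - w)) = C (T u (h *: A w + (T h w - w))) - h *: C (T u (A w)).
  by rewrite CE addrAC subrr add0r.
apply: le_trans (ler_normB _ _) _.
have := CB _ _ u0 De; rewrite Ae => CBe.
have := H1 u r u0 (ltac:(by rewrite r0 (le_lt_trans rh))).
have -> : Num.max 0 (u + r) = u + r by apply/max_idPr; rewrite addr_ge0.
set c1 := C (T (u + r) _); set c0 := C (T u (A w)) => c10.
have c0le : `|c0| <= `|c1| + eta / 2.
  by rewrite -[c0](subKr c1) (le_trans (ler_normB _ _))// lerD2l.
rewrite normrZ (gtr0_norm hp).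
have : h * `|c0| <= h * (`|c1| + eta / 2) by rewrite ler_wpM2l.
have : B * (`|h *: A w + (T h w - w)| + `|h *: A (A w) + (T h (A w) - A w)|)
   <= B * (h * e + h * e) by rewrite ler_wpM2l// lerD.
have : h * (B * (e + e)) <= h * (eta / 2) by rewrite ler_wpM2l.
lra.
Unshelve. all: by end_near. Qed.

End generator.

(** * Combining the square function bound with the lower bound on [C] *)

Theorem theorem4p3 (R : realType) (X Y : completeNormedModType R)
  (T : R -> X -> X) (D : set X) (A : X -> X) (C : X -> Y) (beta : R) :
  bounded_C0_semigroup T ->
  generator T D (fun x => - A x) ->
  (forall x y, D x -> D y -> A x = A y -> x = y) ->
  closure (A @` D) = setT ->
  (forall (a : R) (u v : X), D u -> D v -> C (a *: u + v) = a *: C u + C v) ->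
  (exists c : R, forall x, D x -> `|C x| <= c * (`|x| + `|A x|)) ->
  0 < beta < 1 ->
  (exists K : R, 0 < K /\ forall x : X,
     ((`|x| ^+ 2)%:E <= (K ^+ 2)%:E *
       (\int[lebesgue_measure]_(t in `]0%R, +oo[)
          ((`| t `^ (- beta) *: frac_neg T beta
                 (T (2 * t `^ (2 * beta)) x - T (t `^ (2 * beta)) x) | ^+ 2) / t)%:E))%E) ->
  (exists delta : R, 0 < delta /\ forall x : X, D x -> (A @` D) x ->
     delta * `|frac_neg T beta x| <= `|C (op_inv D A x)|) ->
  exists m : R, 0 < m /\ forall x : X, D x -> (A @` D) x ->
    ((m ^+ 2 * `|x| ^+ 2)%:E <=
      \int[lebesgue_measure]_(t in `[0%R, +oo[) (`|C (T t x)| ^+ 2)%:E)%E.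
Proof.
move=> sgT genA injA _ CL Cbnd /andP[b0 b1] [K [K0 SQ]] [delta [delta0 Rb]].
pose p := 2 * beta; have p0 : 0 < p by rewrite mulr_gt0.
pose q : R := 2 `^ p^-1; have q0 : 0 < q by exact: powR_gt0.
(* Chosen so that m^2 K^2 q / delta^2 = 1. *)
pose m := delta / (K * Num.sqrt q).
have m0 : 0 < m by rewrite divr_gt0// mulr_gt0// sqrtr_gt0.
exists m; split=> // x Dx /[dup] Rx [w Dw wx].
pose g u := `|C (T (Num.max 0 u) x)|.
pose G u := (g u / delta) ^+ 2.
have mg : measurable_fun [set: R] g by exact: (observation_measurable sgT genA CL Cbnd).
have mG : measurable_fun [set: R] G.
  by apply: measurable_funX; exact: measurable_funM.
(* The increments are those of C T(.) w; the transported [Dx] says that A w = x lies in [D]. *)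
have phi_g := observation_increment sgT genA CL Cbnd Dw
  (eq_ind_r D Dx wx).
rewrite wx in phi_g.
have G_int D' : measurable D' ->
    (\int[lebesgue_measure]_(u in D') (G u)%:E =
     (delta ^- 2)%R%:E * \int[lebesgue_measure]_(u in D') (g u ^+ 2)%:E)%E.
  move=> mD'; rewrite -ge0_integralZl_EFin//; last 3 first.
  - by move=> u _; rewrite lee_fin sqr_ge0.
  - apply/measurable_EFinP; apply: measurable_funTS.
    exact: measurable_funX.
  - by rewrite invr_ge0 sqr_ge0.
  apply: eq_integral => u _; rewrite -EFinM; congr (_%:E).
  by rewrite /G expr_div_n mulrC.
(* Pointwise form of the estimate: the integrand of (SQ_beta) is at most that of
   [dilation_integral_le]. *)
have key t : 0 < t ->
    ((`| t `^ (- beta) *: frac_neg T beta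
       (T (2 * t `^ p) x - T (t `^ p) x) | ^+ 2 / t)%:E <=
     (t^-1)%R%:E * \int[lebesgue_measure]_(u in `[(t `^ p)%R, (2 * t `^ p)%R[)
        (G u)%:E)%E.
  move=> t0; pose s := t `^ p; have s0 : 0 < s by exact: powR_gt0.
  rewrite -/s; set z := T (2 * s) x - T s x.
  have s20 : 0 <= 2 * s by rewrite mulr_ge0// ltW.
  pose y := T (2 * s) w - T s w.
  have [D2x A2x] := generator_semigroup sgT genA s20 Dx.
  have [D1x A1x] := generator_semigroup sgT genA (ltW s0) Dx.
  have [D2w A2w] := generator_semigroup sgT genA s20 Dw.
  have [D1w A1w] := generator_semigroup sgT genA (ltW s0) Dw.
  have [Dz _] := generator_subr sgT genA D2x D1x.
  have [Dy Ay] := generator_subr sgT genA D2w D1w.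
  have yz : A y = z by rewrite Ay A2w A1w wx.
  have invz : op_inv D A z = y.
    apply: xget_unique => // y' [Dy' Ay']; apply: injA => //.
    by rewrite Ay' yz.
  have := Rb z Dz (ex_intro2 _ _ y Dy yz).
  rewrite invz (observation_subr CL) // => Rz.
  have := sqr_increment_le mg phi_g (ltW s0) s0.
  rewrite (_ : s + s = 2 * s); last by rewrite mulr2n mulrDl mul1r.
  set d := `|C (T (2 * s) w) - C (T s w)| in Rz *; set J := integral _ _ _ => dJ.
  rewrite G_int// -/J.
  (* Squaring the scalar gives t^(-2 beta) = 1/s, which will absorb the factor s of the
     Cauchy-Schwarz bound over [s, 2s]. *)
  have -> : (`|t `^ (- beta) *: frac_neg T beta z| ^+ 2 / t)%R =
      (t^-1 * s^-1 * `|frac_neg T beta z| ^+ 2)%R.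
    rewrite normrZ exprMn ger0_norm ?powR_ge0// -powR_mulrn ?powR_ge0//.
    rewrite -powRrM mulNr powRN (mulrC beta) -/p -/s.
    by rewrite mulrC mulrA.
  apply: (@le_trans _ _ (t^-1 * s^-1 * (delta ^- 2 * d ^+ 2))%R%:E).
    rewrite lee_fin; apply: ler_wpM2l.
      by rewrite mulr_ge0 ?invr_ge0 ?(ltW t0) ?(ltW s0).
    rewrite ler_pdivlMl ?exprn_gt0// -exprMn.
    have d0 : 0 <= d by exact: normr_ge0.
    by apply: lerXn2r; rewrite ?nnegrE ?mulr_ge0 ?(ltW delta0).
  have -> : (t^-1 * s^-1 * (delta ^- 2 * d ^+ 2))%R =
            (t^-1 * (delta ^- 2 * (s^-1 * d ^+ 2)))%R by ring.
  rewrite EFinM lee_wpmul2l ?lee_fin ?invr_ge0 ?(ltW t0)//.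
  rewrite EFinM lee_wpmul2l ?lee_fin ?invr_ge0 ?sqr_ge0//.
  by rewrite EFinM muleC lee_pdivrMr// muleC.
have G0 u : 0 <= G u by exact: sqr_ge0.
move: (SQ x); set S := (\int[_]_(_ in _) _)%E => xS.
set I := (\int[_]_(_ in _) _)%E.
have SI : (S <= q%:E * ((delta ^- 2)%R%:E * I))%E.
  (* The clamp is invisible on nonnegative times. *)
  have -> : I = (\int[lebesgue_measure]_(u in `[0%R, +oo[) (g u ^+ 2)%:E)%E.
    apply: eq_integral => u; rewrite inE/= in_itv/= andbT => u0.
    by rewrite /g max_r.
  rewrite -G_int//; apply: le_trans (dilation_integral_le p0 mG G0).
  apply: ge0_le_integral_nomeas => t; rewrite /= in_itv/= andbT => t0.
    by rewrite lee_fin mulr_ge0 ?sqr_ge0 ?invr_ge0 ?(ltW t0).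
  exact: key.
have m2 : m ^+ 2 * K ^+ 2 * q * delta ^- 2 = 1.
  rewrite /m expr_div_n exprMn sqr_sqrtr ?(ltW q0)//.
  by field; rewrite !gt_eqF.
(* [I] may be infinite, so the constants are multiplied out to 1 in the extended reals. *)
apply: le_trans (_ : ((m ^+ 2)%:E * ((K ^+ 2)%:E *
  (q%:E * ((delta ^- 2)%R%:E * I))) <= _)%E).
  rewrite EFinM lee_wpmul2l ?lee_fin ?sqr_ge0//; apply: le_trans xS _.
  by rewrite lee_wpmul2l ?lee_fin ?sqr_ge0.
by rewrite !muleA -!EFinM m2 mul1e.
Qed.
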